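(* There exist a universal constant $C>0$ and a universal $\widetilde T$ such that the following holds. For every $T\ge\widetilde T$ and every $\epsilon$, there exist a sequence $g_1,\dots,g_T\in\mathbb{R}$ and a comparator sequence $u_1,\dots,u_T\in\mathbb{R}$, not depending on the algorithm, such that for every one-dimensional online linear optimization algorithm $\mathcal A$ which satisfies conditions (1)–(4) of the context and which guarantees $\sum_{i=1}^t g_i' w_i'\le\epsilon$ for all $t$ on every sequence $(g_i')$ with $|g'_i|=1$ for all $i$ (where $w'_i$ are its outputs on that sequence), the outputs $w_1,\dots,w_T$ of $\mathcal A$ on $g_1,\dots,g_T$ satisfy $$\sum_{t=1}^T g_t(w_t-u_t)\ge\frac{C}{16}\left(P_T+\max_t|u_t|\right)\sqrt T,$$ and moreover $$P_T+\max_t|u_t|\in\left[\frac{\epsilon\sqrt{2T}}{C^3},\ \frac{8\epsilon\sqrt T}{C^3}\right],$$ where $P_T=\sum_{t=1}^{T-1}|u_t-u_{t+1}|$. Moreover, $C$ can be taken to be a constant with the following property: for any $\epsilon$ and any one-dimensional online linear optimization algorithm $\mathcal A$ which satisfies conditions (1)–(4) of the context and which guarantees $\sum_{i=1}^s g_i' w_i'\le\epsilon$ for all $s$ on every sequence $(g_i')$ with $|g_i'|=1$ for all $i$ (where $w_i'$ are its outputs on that sequence), and for any $t$ and any $g_1,\dots,g_t$ with $|g_i|=1$ for all $i\le t$ and $|g_1+\dots+g_t|\le C\sqrt t/2$, the output $w_{t+1}$ of $\mathcal A$ after receiving $g_1,\dots,g_t$ satisfies $|w_{t+1}|\le 2\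epsilon/C^2$.
   Context: A one-dimensional online linear optimization algorithm (domain $\mathbb{R}$) outputs $w_t\in\mathbb{R}$ in round $t$ and then receives $g_t\in\mathbb{R}$. Write $g_{1:t}=\sum_{i=1}^t g_i$. Conditions on the algorithm: (1) $w_{t+1}=F_t(g_{1:t},|g_1|,\dots,|g_t|)$ for some functions $F_t$ (below, the dependence on $|g_1|,\dots,|g_t|$ is suppressed and these values are held fixed); for the first round, the sum is empty and $w_1=0$. (2) $\mathrm{sign}(F_t(g_{1:t}))=-\mathrm{sign}(g_{1:t})$ (with $\mathrm{sign}(0)=0$). (3) $F_t$ is odd in its first argument: $F_t(g_{1:t})=-F_t(-g_{1:t})$. (4) $x\mapsto F_t(-x)$ is non-decreasing for positive $x$.
   Formalization: In the first part, ''every ε'' is restricted to ε ≥ 0: for ε < 0 the required interval [ε√(2T)/C³, 8ε√T/C³] is empty (and its upper end negative), so no comparator sequence could satisfy the claim. *)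

(* Defs.v *)
From mathcomp Require Import all_boot all_order all_algebra.
From mathcomp Require Import reals.

Set Implicit Arguments.
Unset Strict Implicit.
Unset Printing Implicit Defensive.

Import Order.TTheory GRing.Theory Num.Theory.
Local Open Scope ring_scope.

(* Rounds are numbered from 1: a sequence g : nat -> R stands for
   g 1, g 2, ..., and g 0 is never used. *)

(* A deterministic algorithm on the domain R: it maps the feedback received so
   far, oldest first, to the next output. *)
Definition olo_algorithm (R : realType) := seq R -> R.

(* w_t = A [:: g 1; ...; g t.-1] *)
Definition output (R : realType) (A : olo_algorithm R) (g : nat -> R)
    (t : nat) : R :=
  A [seq g i | i <- index_iota 1 t].

(* F t x m is F_t(x, m_1, ..., m_t).  The magnitudes that are "held fixed" in
   the sign, oddness and monotonicity conditions are those of an arbitrary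
   history h, with t = size h; the first argument x is then any real number. *)
Definition sum_representation (R : realType) (A : olo_algorithm R)
    (F : nat -> R -> seq R -> R) : Prop :=
  A [::] = 0 /\
  forall h : seq R,
    A h = F (size h) (\sum_(x <- h) x) [seq `|x| | x <- h].

Definition opposite_sign (R : realType) (F : nat -> R -> seq R -> R) : Prop :=
  forall (h : seq R) (x : R),
    Num.sg (F (size h) x [seq `|y| | y <- h]) = - Num.sg x.

Definition odd_first (R : realType) (F : nat -> R -> seq R -> R) : Prop :=
  forall (h : seq R) (x : R),
    F (size h) x [seq `|y| | y <- h] = - F (size h) (- x) [seq `|y| | y <- h].

Definition monotone_neg (R : realType) (F : nat -> R -> seq R -> R) : Prop :=
  forall (h : seq R) (x y : R), 0 < x -> x <= y ->
    F (size h) (- x) [seq `|z| | z <- h] <=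
    F (size h) (- y) [seq `|z| | z <- h].

Definition regular_algorithm (R : realType) (A : olo_algorithm R) : Prop :=
  exists F : nat -> R -> seq R -> R,
    [/\ sum_representation A F, opposite_sign F, odd_first F
      & monotone_neg F].

Definition origin_guarantee (R : realType) (A : olo_algorithm R) (eps : R)
    : Prop :=
  forall g : nat -> R, (forall i : nat, (1 <= i)%N -> `|g i| = 1) ->
  forall t : nat, (1 <= t)%N ->
    \sum_(1 <= i < t.+1) g i * output A g i <= eps.

Definition path_length (R : realType) (T : nat) (u : nat -> R) : R :=
  \sum_(1 <= t < T) `|u t - u t.+1|.

Definition max_norm (R : realType) (T : nat) (u : nat -> R) : R :=
  \big[Num.max/0]_(1 <= t < T.+1) `|u t|.

Definition dynamic_regret (R : realType) (A : olo_algorithm R) (T : nat)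
    (g u : nat -> R) : R :=
  \sum_(1 <= t < T.+1) g t * (output A g t - u t).

(* Main.v *)
Require Import Defs.
From mathcomp Require Import all_boot all_order all_algebra.
From mathcomp Require Import reals.
From mathcomp Require Import zify ring lra.

Set Implicit Arguments.
Unset Strict Implicit.
Unset Printing Implicit Defensive.

Import Order.TTheory GRing.Theory Num.Theory.
Local Open Scope ring_scope.

(** Write [S_t] for the sum of the first [t] feedbacks.  If all feedbacks are
    signs, an algorithm with cumulative loss at most [eps] cannot bet more than
    its wealth [eps - loss], since the next sign may go against it.  By
    monotonicity, a large output [m] at a sum [x] with [16 * x ^ 2 <= t] forces
    wealth at least [m] at every history with [|S_t| >= |x|].  For random signs
    the wealth is a martingale of mean [eps], while a fourth moment estimate
    gives this event probability at least 1/4; hence [m <= 4 * eps].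

    For the lower bound, the feedback alternates for about a quarter of the
    rounds, which never produces a gain for the algorithm, and then comes in
    blocks of length [L] of order [sqrt T] and of alternating sign.  The sums
    stay in [[0, L]], so the outputs stay below [4 * eps], whereas the
    comparator [-24 * eps * sign] earns [24 * eps] per round at the price of
    only [T / L] switches. *)

(** * Sign histories and cumulative loss *)

Definition signs (R : realType) (h : seq R) : bool := all (fun x => `|x| == 1) h.

Definition loss (R : realType) (A : olo_algorithm R) (h : seq R) : R :=
  \sum_(i < size h) h`_i * A (take i h).

Lemma signs_rcons (R : realType) (h : seq R) (x : R) :
  signs (rcons h x) = (`|x| == 1) && signs h.
Proof. exact: all_rcons. Qed.

Lemma map_norm_signs (R : realType) (h : seq R) :
  signs h -> [seq `|x| | x <- h] = nseq (size h) 1.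
Proof.
by elim: h => //= x h IH /andP[/eqP -> /IH ->].
Qed.

Lemma loss_rcons (R : realType) (A : olo_algorithm R) (h : seq R) (x : R) :
  loss A (rcons h x) = loss A h + x * A h.
Proof.
rewrite /loss size_rcons big_ord_recr /=; congr (_ + _).
  by apply: eq_bigr => i _; rewrite nth_rcons ltn_ord -cats1 takel_cat // ltnW.
by rewrite nth_rcons ltnn eqxx -cats1 take_size_cat.
Qed.

Lemma loss_le (R : realType) (A : olo_algorithm R) (eps : R) (h : seq R) :
  origin_guarantee A eps -> (0 < size h)%N -> signs h -> loss A h <= eps.
Proof.
(* The guarantee concerns infinite sequences, so [h] is continued by ones; [i.-1] appears because
   rounds start at 1. *)
move=> guar h_gt0 sh; pose g i := nth 1 h i.-1.
have g1 i : (1 <= i)%N -> `|g i| = 1.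
  move=> _; rewrite /g; have [lt_ih|le_hi] := ltnP i.-1 (size h).
    exact/eqP/(allP sh)/mem_nth.
  by rewrite nth_default ?normr1.
apply: le_trans (guar g g1 _ h_gt0); rewrite le_eqVlt; apply/orP; left; apply/eqP.
rewrite big_add1 /= big_mkord; apply: eq_bigr => i _; rewrite /g /=.
rewrite (set_nth_default 1) ?ltn_ord //; congr (_ * A _).
rewrite /index_iota subn1 /= -(map_nth_iota0 1) ?(ltnW (ltn_ord i)) //.
by rewrite -[1%N]/(1 + 0)%N iotaDl -map_comp.
Qed.

(** The next sign may agree with that of [A h], which adds [|A h|] to the loss. *)
Lemma loss_norm_le (R : realType) (A : olo_algorithm R) (eps : R) (h : seq R) :
  origin_guarantee A eps -> signs h -> loss A h + `|A h| <= eps.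
Proof.
move=> guar sh.
have next x : `|x| = 1 -> loss A h + x * A h <= eps.
  move=> x1; rewrite -loss_rcons; apply: loss_le => //.
    by rewrite size_rcons.
  by rewrite signs_rcons x1 eqxx.
have [A0|A0] := leP 0 (A h).
  by rewrite ger0_norm //; have := next 1 (normr1 R); rewrite mul1r.
rewrite ltr0_norm //; have := next (-1).
by rewrite normrN1 mulN1r; apply.
Qed.

(** [Phi k h] plays the role of a mean over [k] further random signs; one of the two continuations
    is always at least their average, so following it derandomizes the martingale argument. *)
Lemma exists_favorable_signs (R : realType) (Phi : nat -> seq R -> R) :
  (forall k h, Phi k.+1 h *+ 2 <= Phi k (rcons h 1) + Phi k (rcons h (-1))) ->
  forall k, exists h, [/\ size h = k, signs h & Phi k [::] <= Phi 0%N h].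
Proof.
move=> step k.
suff ext j h : signs h ->
    exists h', [/\ size h' = (size h + j)%N, signs h' & Phi j h <= Phi 0%N h'].
  by have [//|h' [sz sh le]] := ext k [::]; exists h'.
elim: j h => [|j IH] h sh; first by exists h; rewrite addn0.
have [x x1 le_x] : exists2 x : R, `|x| == 1 & Phi j.+1 h <= Phi j (rcons h x).
  have [le1|lt1] := leP (Phi j.+1 h) (Phi j (rcons h 1)).
    by exists 1; rewrite ?normr1.
  exists (-1); rewrite ?normrN1 //.
  have := step j h; rewrite mulr2n; lra.
have [|h' [sz sh' le']] := IH (rcons h x); first by rewrite signs_rcons x1.
exists h'; split=> //; first by rewrite sz size_rcons addSnnS.
exact: le_trans le_x le'.
Qed.

(** * Bound on the outputs near a zero sum *)

Lemma output_nil (R : realType) (A : olo_algorithm R) :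
  regular_algorithm A -> A [::] = 0.
Proof. by case=> F [[]]. Qed.

(** Equal lengths and unit magnitudes make both outputs values of one function [f], whose modulus is
    even by oddness. *)
Lemma regular_norm_le (R : realType) (A : olo_algorithm R) (h h' : seq R) :
  regular_algorithm A -> size h' = size h -> signs h -> signs h' ->
  `|\sum_(x <- h) x| <= `|\sum_(x <- h') x| -> `|A h| <= `|A h'|.
Proof.
case=> F [[_ AF] opp odd mono] sz sh sh'.
pose f x := F (size h) x [seq `|y| | y <- h].
have {}opp x : Num.sg (f x) = - Num.sg x by exact: opp.
have {}odd x : f x = - f (- x) by exact: odd.
have {}mono x y : 0 < x -> x <= y -> f (- x) <= f (- y) by exact: mono.
rewrite !AF (map_norm_signs sh') sz -(map_norm_signs sh) -!/(f _).
have even x : `|f x| = `|f (- `|x|)|.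
  have [x0|x0] := leP 0 x; first by rewrite [`|x|]ger0_norm // odd normrN.
  by rewrite [`|x|]ltr0_norm // opprK.
rewrite (even (\sum_(x <- h) x)) (even (\sum_(x <- h') x)) => le.
set a := `|_| in le *; set b := `|_| in le *.
have fN0 x : 0 <= x -> 0 <= f (- x).
  by rewrite -(sgr_ge0 (f _)) opp sgrN opprK sgr_ge0.
have a0 : 0 <= a by exact: normr_ge0.
rewrite !ger0_norm ?fN0 ?normr_ge0 //.
(* Monotonicity covers positive arguments only; at 0 the sign condition gives [f 0 = 0]. *)
move: a0; rewrite le_eqVlt => /orP[/eqP <-|a0]; last exact: mono.
have /eqP : Num.sg (f (- 0)) = 0 by rewrite opp oppr0 sgr0 oppr0.
by rewrite sgr_eq0 => /eqP ->; rewrite fN0 ?normr_ge0.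
Qed.

Lemma regular_bound (R : realType) (A : olo_algorithm R) (eps : R) (h : seq R) :
  regular_algorithm A -> origin_guarantee A eps -> signs h ->
  16%:R * (\sum_(x <- h) x) ^+ 2 <= (size h)%:R -> `|A h| <= 4%:R * eps.
Proof.
move=> reg guar sh small.
have := loss_norm_le (h := [::]) guar isT.
have A0 := output_nil reg.
rewrite /loss big_ord0 A0 normr0 addr0 => eps0.
case: (posnP (size h)) => [/size0nil -> | n0]; first by rewrite A0 normr0; lra.
set n : R := (size h)%:R in small.
have {n0} n0 : 0 < n by rewrite ltr0n.
set m := `|A h|; have m0 : 0 <= m by exact: normr_ge0.
pose S (s : seq R) := \sum_(x <- s) x.
have S_rcons s x : S (rcons s x) = S s + x by rewrite /S big_rcons.
(* [Phi k s] is the mean of [9 n ^ 2 loss + m (S ^ 2 - n / 16) (6 n - S ^ 2)]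
   when [k] more random signs are appended to [s]; the quadratic in [S ^ 2]
   minorizes [9 n ^ 2] times the indicator of [16 S ^ 2 >= n]. *)
pose Phi (k : nat) s := 9%:R * n ^+ 2 * loss A s
  + m * ((6%:R * n + n / 16%:R) * (S s ^+ 2 + k%:R)
      - (S s ^+ 4 + 6%:R * k%:R * S s ^+ 2 + 3%:R * k%:R ^+ 2 - 2%:R * k%:R)
      - 6%:R / 16%:R * n ^+ 2).
(* Equality holds: the two loss increments cancel, and [3 k ^ 2 - 2 k] is the fourth moment of a sum
   of [k] random signs. *)
have step k s : Phi k.+1 s *+ 2 <= Phi k (rcons s 1) + Phi k (rcons s (-1)).
  rewrite /Phi !loss_rcons !S_rcons -(natr1 k) le_eqVlt; apply/orP; left.
  by apply/eqP; ring.
have [h' [sz sh' le_Phi]] := exists_favorable_signs step (size h).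
have guar' := loss_norm_le guar sh'.
have main : m * ((S h' ^+ 2 - n / 16%:R) * (6%:R * n - S h' ^+ 2))
    <= 9%:R * n ^+ 2 * `|A h'|.
  have [lt|le] := ltP (S h' ^+ 2) (n / 16%:R).
    apply: (@le_trans _ _ 0); last by rewrite !mulr_ge0 ?sqr_ge0.
    rewrite mulr_ge0_le0 // nmulr_rle0; lra.
  have le_m : m <= `|A h'|.
    apply: regular_norm_le => //.
    rewrite -(ler_pXn2r (n := 2)) ?nnegrE ?normr_ge0 // !real_normK ?num_real //.
    by move: le; rewrite -/(S h) -/(S h') /S; lra.
  apply: (@le_trans _ _ (m * (9%:R * n ^+ 2))); last first.
    by rewrite mulrC ler_wpM2l // mulr_ge0 ?sqr_ge0.
  rewrite ler_wpM2l //.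
  (* The quadratic peaks at [S ^ 2 = 97 n / 32], with value [(95 n / 32) ^ 2 <= 9 n ^ 2]. *)
  have := sqr_ge0 (S h' ^+ 2 - 97%:R / 32%:R * n); have := sqr_ge0 n; lra.
(* The initial value is [m * (43/16 n ^ 2 + 2 n)], at least [9/4 m n ^ 2], while [main] and [guar']
   bound the final value by [9 n ^ 2 eps]. *)
move: le_Phi; rewrite /Phi {1}/loss big_ord0 /S big_nil -/(S h') -/n => le_Phi.
have n2 : 0 < n ^+ 2 by rewrite exprn_gt0.
have mn : 0 <= m * n by rewrite mulr_ge0 // ltW.
have guar2 : n ^+ 2 * (loss A h' + `|A h'|) <= n ^+ 2 * eps by rewrite ler_pM2l.
rewrite -(ler_pM2l n2).
have mn2 : 0 <= m * n ^+ 2 by rewrite mulr_ge0 // ltW.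
nra.
Qed.

(** * Alternating blocks of signs *)

Definition block_sign (R : realType) (L t : nat) : R := (-1) ^+ (t.-1 %/ L)%N.

Lemma norm_block_sign (R : realType) (L t : nat) : `|block_sign R L t| = 1.
Proof. by rewrite /block_sign normrX normrN1 expr1n. Qed.

(** A triangle wave: the sum climbs to [L] over one block and returns to 0 over the next. *)
Lemma sum_block_sign (R : realType) (L t : nat) : (0 < L)%N ->
  \sum_(1 <= i < t.+1) block_sign R L i
    = (if odd (t %/ L) then L - t %% L else t %% L)%N%:R.
Proof.
move=> L0; elim: t => [|t IH]; first by rewrite big_geq // div0n mod0n.
rewrite big_nat_recr //= IH /block_sign /= -signr_odd divnS // modnS.
have lt := ltn_pmod t L0.
case: (boolP (L %| t.+1)%N) => dv /=; last first.
  rewrite add0n; case: (odd _); last by rewrite expr0 natr1.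
  by rewrite expr1 !natrB ?(ltnW lt) // -natr1; ring.
have eL : L = (t %% L)%N.+1.
  suff /dvdn_leq : (L %| (t %% L).+1)%N by lia.
  by rewrite /dvdn -addn1 modnDml addn1.
rewrite oddD /=; case: (odd _) => /=; rewrite ?expr1 ?expr0 ?subn0.
  by rewrite [X in (X - _)%N]eL subSnn subrr.
by rewrite natr1 -eL.
Qed.

(** The comparator jumps after round [t] exactly when [L] divides [t], by [2 c] each time. *)
Lemma path_length_block_sign (R : realType) (L T : nat) (c : R) :
  (0 < L)%N -> 0 <= c ->
  path_length T (fun t => - c * block_sign R L t) = 2%:R * c * (T.-1 %/ L)%N%:R.
Proof.
move=> L0 c0; rewrite /path_length.
case: T => [|T]; first by rewrite big_geq // div0n mulr0.
elim: T => [|T IH]; first by rewrite big_geq // div0n mulr0.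
rewrite big_nat_recr //= IH /block_sign /= divnS // natrD mulrDr addrC.
congr (_ + _); rewrite exprD -mulrBr normrM normrN (ger0_norm c0).
case: (L %| T.+1)%N => /=; last by rewrite expr0 mul1r subrr normr0 !mulr0.
rewrite expr1 mulN1r opprK -mulr2n normrMn normrX normrN1 expr1n; ring.
Qed.

Lemma max_norm_bounds (R : realType) (T : nat) (u : nat -> R) (c : R) :
  0 <= c -> (forall t, `|u t| <= c) -> 0 <= max_norm T u <= c.
Proof.
by move=> c0 uc; rewrite /max_norm bigmax_ge_id /= bigmax_le.
Qed.

(** * Outputs and regret on the hard sequence *)

Lemma signs_prefix (R : realType) (g : nat -> R) (t : nat) :
  (forall i : nat, (1 <= i <= t)%N -> `|g i| = 1) ->
  signs [seq g i | i <- index_iota 1 t.+1].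
Proof.
move=> g1; apply/allP => x /mapP[i]; rewrite mem_index_iota ltnS => it ->.
by rewrite g1.
Qed.

Lemma output_bound (R : realType) (A : olo_algorithm R) (eps : R)
    (g : nat -> R) (t : nat) :
  regular_algorithm A -> origin_guarantee A eps ->
  (forall i : nat, (1 <= i <= t)%N -> `|g i| = 1) ->
  16%:R * (\sum_(1 <= i < t.+1) g i) ^+ 2 <= t%:R ->
  `|output A g t.+1| <= 4%:R * eps.
Proof.
move=> reg guar g1 small; apply: regular_bound => //; first exact: signs_prefix.
by rewrite size_map size_iota subn1 big_map.
Qed.

Lemma sgr_output (R : realType) (A : olo_algorithm R) (g : nat -> R) (t : nat) :
  regular_algorithm A ->
  Num.sg (output A g t) = - Num.sg (\sum_(1 <= i < t) g i).
Proof. by case=> F [[_ AF] opp _ _]; rewrite /output AF opp big_map. Qed.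

(* [16 L ^ 2] rounds build up the elapsed time needed for the running sums of
   the later blocks, which lie in [[0, L]], to be within reach of
   [output_bound]. *)
Definition hard_sequence (R : realType) (L t : nat) : R :=
  if (t <= 16 * L ^ 2)%N then block_sign R 1 t else block_sign R L t.

Lemma norm_hard_sequence (R : realType) (L t : nat) :
  `|hard_sequence R L t| = 1.
Proof. by rewrite /hard_sequence; case: ifP; rewrite norm_block_sign. Qed.

(** Since [2 L] divides [16 L ^ 2], both the fast alternation and the [L]-blocks sum to 0 over the
    first phase, so one may be exchanged for the other. *)
Lemma sum_hard_sequence (R : realType) (L t : nat) :
  (0 < L)%N -> (16 * L ^ 2 <= t)%N ->
  0 <= \sum_(1 <= i < t.+1) hard_sequence R L i <= L%:R.
Proof.
move=> L0 Et; set E := (16 * L ^ 2)%N in Et.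
have sumE K : (0 < K)%N -> (K * 2 %| E)%N ->
    \sum_(1 <= i < E.+1) block_sign R K i = 0.
  move=> K0 /dvdnP[q ->]; rewrite sum_block_sign // [(K * 2)%N]mulnC mulnA mulnK //.
  by rewrite oddM andbF modnMl.
have E1 : (1 * 2 %| E)%N by rewrite /E mul1n -[16%N]/(2 * 8)%N -mulnA dvdn_mulr.
have EL : (L * 2 %| E)%N.
  have -> : E = (L * 2 * (8 * L))%N by rewrite /E -mulnn; nia.
  exact: dvdn_mulr.
have -> : \sum_(1 <= i < t.+1) hard_sequence R L i
    = \sum_(1 <= i < t.+1) block_sign R L i.
  rewrite !(big_cat_nat (n := E.+1) (m := 1%N) (p := t.+1)) //= sumE //.
  congr (_ + _); last first.
    by apply: eq_big_nat => i /andP[lt _]; rewrite /hard_sequence leqNgt lt.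
  rewrite -[RHS](sumE 1%N) //.
  by apply: eq_big_nat => i /andP[_ le]; rewrite /hard_sequence -ltnS le.
rewrite sum_block_sign // ler0n ler_nat; case: ifP => _.
  exact: leq_subr.
exact/ltnW/ltn_pmod.
Qed.

Lemma regret_hard_sequence (R : realType) (A : olo_algorithm R) (eps c : R)
    (L T : nat) :
  regular_algorithm A -> origin_guarantee A eps ->
  (0 < L)%N -> 0 <= c -> (16 * L ^ 2 <= T)%N ->
  (T%:R - 16%:R * L%:R ^+ 2) * (c - 4%:R * eps) - 16%:R * L%:R ^+ 2 * c
    <= dynamic_regret A T (hard_sequence R L)
         (fun t => - c * block_sign R L t).
Proof.
move=> reg guar L0 c0 ET; set E := (16 * L ^ 2)%N in ET.
have EE : 16%:R * L%:R ^+ 2 = E%:R :> R by rewrite /E natrM natrX.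
(* The sum before each of these rounds is 0 or 1: the output is then 0, or negative and met by the
   sign [-1]. *)
have early t : (t <= E)%N ->
    0 <= hard_sequence R L t * output A (hard_sequence R L) t.
  move=> tE; case: t tE => [|t] tE.
    by rewrite /output /index_iota /= (output_nil reg) mulr0.
  have sgw := sgr_output (hard_sequence R L) t.+1 reg.
  have sumt : \sum_(1 <= i < t.+1) hard_sequence R L i = (odd t)%:R.
    rewrite (@eq_big_nat _ _ _ _ _ _ (block_sign R 1)).
      by rewrite sum_block_sign // divn1 modn1 subn0; case: odd.
    by move=> i /andP[_ it]; rewrite /hard_sequence (leq_trans (ltnW it) tE).
  rewrite -sgr_ge0 sgrM sgw sumt /hard_sequence tE /block_sign divn1 /=.
  rewrite -signr_odd; case: (odd t).
    by rewrite expr1 sgrN sgr1 mulrNN mulr1.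
  by rewrite sgr0 oppr0 mulr0.
have late t : (E < t)%N -> `|output A (hard_sequence R L) t| <= 4%:R * eps.
  case: t => // t Et; apply: output_bound => //.
    by move=> i _; exact: norm_hard_sequence.
  have /andP[s0 sL] := sum_hard_sequence R L0 Et.
  apply: (@le_trans _ _ (16%:R * L%:R ^+ 2)).
    by rewrite ler_pM2l // lerXn2r ?nnegrE.
  by rewrite EE ler_nat.
have const m n (x : R) : \sum_(m <= t < n) x = (n - m)%:R * x.
  by rewrite sumr_const_nat mulr_natl.
rewrite /dynamic_regret (big_cat_nat (n := E.+1)) //= addrC EE.
apply: lerD; last first.
  have -> : - (E%:R * c) = \sum_(1 <= t < E.+1) - c.
    by rewrite const subn1 mulrN.
  apply: ler_sum_nat => t; rewrite ltnS => /andP[_ tE].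
  have : hard_sequence R L t * (- c * block_sign R L t) <= c.
    apply: le_trans (ler_norm _) _; rewrite !normrM norm_hard_sequence.
    by rewrite norm_block_sign normrN ger0_norm // mul1r mulr1.
  by have := early t tE; rewrite mulrBr; lra.
rewrite -natrB // -subSS -const; apply: ler_sum_nat => t /andP[Et _].
have := late t Et; rewrite ler_norml => wt.
rewrite /hard_sequence leqNgt Et /=; set w := output _ _ _ in wt *.
rewrite /block_sign -signr_odd; case: (odd _); rewrite ?expr1 ?expr0; lra.
Qed.

(** * Choice of the block length and of the constants *)

Lemma sqrt_block_length (T : nat) :
  exists L, (64 * L ^ 2 <= T < 64 * L.+1 ^ 2)%N.
Proof.
elim: T => [|T [L /andP[lo hi]]]; first by exists 0%N.
have [lt|ge] := ltnP T.+1 (64 * L.+1 ^ 2).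
  by exists L; rewrite lt leqW.
by exists L.+1; rewrite ge (leq_ltn_trans hi) // ltn_pmul2l // ltn_exp2r.
Qed.

(** [T / L] is about [64 L]; the rounding error of about 128 blocks is absorbed by one extra [L], as
    [L >= 200]. *)
Lemma block_count_bounds (T L : nat) :
  (200 <= L)%N -> (64 * L ^ 2 <= T)%N -> (T < 64 * L.+1 ^ 2)%N ->
  (64 * L <= (T.-1 %/ L).+1)%N /\ (T.-1 %/ L <= 65 * L)%N.
Proof.
move=> L200; have L0 : (0 < L)%N by apply: leq_trans L200.
rewrite -!mulnn => lo hi; split; last by rewrite -ltnS ltn_divLR //; nia.
have : (64 * L - 1 <= T.-1 %/ L)%N by rewrite leq_divRL //; nia.
by rewrite leq_subLR add1n.
Qed.

Theorem theorem3 (R : realType) :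
  exists C : R, exists T0 : nat,
    [/\ 0 < C,
        (forall (T : nat) (eps : R), (T0 <= T)%N -> 0 <= eps ->
         exists g u : nat -> R,
           (forall A : olo_algorithm R,
              regular_algorithm A -> origin_guarantee A eps ->
              C / 16%:R * (path_length T u + max_norm T u) * Num.sqrt T%:R
                <= dynamic_regret A T g u) /\
           eps * Num.sqrt (2%:R * T%:R) / C ^+ 3
             <= path_length T u + max_norm T u
             <= 8%:R * eps * Num.sqrt T%:R / C ^+ 3)
      & (forall (eps : R) (A : olo_algorithm R),
           regular_algorithm A -> origin_guarantee A eps ->
         forall (t : nat) (g : nat -> R),
           (forall i : nat, (1 <= i <= t)%N -> `|g i| = 1) ->
           `|\sum_(1 <= i < t.+1) g i| <= C * Num.sqrt t%:R / 2%:R ->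
           `|output A g t.+1| <= 2%:R * eps / C ^+ 2)].
Proof.
(* The threshold on [T] forces [L >= 200]; with [C = 1/4] the interval to hit is
   [[64 eps sqrt (2 T), 512 eps sqrt T]]. *)
exists (4%:R^-1), (64 * 200 ^ 2)%N; split; first by rewrite invr_gt0.
- move=> T eps T_large eps0.
  have [L /andP[lo hi]] := sqrt_block_length T.
  have L200 : (200 <= L)%N.
    rewrite leqNgt; apply/negP => L_lt.
    have : (64 * L.+1 ^ 2 <= 64 * 200 ^ 2)%N by rewrite leq_pmul2l // leq_exp2r.
    by rewrite leqNgt (leq_ltn_trans T_large hi).
  have L0 : (0 < L)%N by apply: leq_trans L200.
  (* The factor 24 is large enough for the regret, at least [(48 * 20 - 16 * 24) eps L ^ 2 = 576 eps
     L ^ 2] against a target below [443 eps L ^ 2], and small enough that [P + M <= 131 * 24 eps L]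
     stays below [512 * 8 eps L]. *)
  pose c := 24%:R * eps.
  have c0 : 0 <= c by rewrite mulr_ge0.
  exists (hard_sequence R L), (fun t => - c * block_sign R L t).
  have path := path_length_block_sign T L0 c0.
  have /andP[max0 maxc] : 0 <= max_norm T (fun t => - c * block_sign R L t) <= c.
    apply: max_norm_bounds => // t.
    by rewrite normrM norm_block_sign normrN ger0_norm // mulr1.
  set P := path_length _ _ in path *; set M := max_norm _ _ in max0 maxc *.
  have Llo : 200%:R <= L%:R :> R by rewrite ler_nat.
  have Tlo : 64%:R * L%:R ^+ 2 <= T%:R :> R by rewrite -natrX -natrM ler_nat.
  have Thi : T%:R <= 64%:R * (L%:R + 1) ^+ 2 :> R.
    by rewrite natr1 -natrX -natrM ler_nat ltnW.
  set r := Num.sqrt T%:R.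
  have r0 : 0 <= r by exact: sqrtr_ge0.
  have rr : r ^+ 2 = T%:R by rewrite sqr_sqrtr.
  have rlo : 8%:R * L%:R <= r.
    by rewrite -(ler_pXn2r (n := 2)) ?nnegrE ?mulr_ge0 // rr; lra.
  have rhi : r <= 8%:R * (L%:R + 1).
    by rewrite -(ler_pXn2r (n := 2)) ?nnegrE ?mulr_ge0 ?addr_ge0 // rr; lra.
  have [count_lo count_hi] := block_count_bounds L200 lo hi.
  have switch_lo : 64%:R * L%:R - 1 <= (T.-1 %/ L)%N%:R :> R.
    by move: count_lo; rewrite -(ler_nat R) natrM -natr1; lra.
  have switch_hi : (T.-1 %/ L)%N%:R <= 65%:R * L%:R :> R.
    by rewrite -natrM ler_nat.
  have total_hi : P + M <= 131%:R * (c * L%:R).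
    have : c * (T.-1 %/ L)%N%:R <= c * (65%:R * L%:R) by rewrite ler_wpM2l.
    have : c * 200%:R <= c * L%:R by rewrite ler_wpM2l.
    lra.
  have total_lo : 127%:R * (c * L%:R) <= P + M.
    have : c * (64%:R * L%:R - 1) <= c * (T.-1 %/ L)%N%:R by rewrite ler_wpM2l.
    have : c * 200%:R <= c * L%:R by rewrite ler_wpM2l.
    lra.
  have eps_r_hi : eps * r <= eps * (9%:R * L%:R) by rewrite ler_wpM2l //; lra.
  have eps_r_lo : eps * (8%:R * L%:R) <= eps * r by rewrite ler_wpM2l.
  have epsL : 0 <= eps * L%:R by rewrite mulr_ge0.
  split.
    move=> A reg guar.
    apply: le_trans (regret_hard_sequence reg guar L0 c0 _); last first.
      by apply: leq_trans lo; rewrite leq_pmul2r // expn_gt0 L0.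
    have le1 : (P + M) * r <= 131%:R * (c * L%:R) * (9%:R * L%:R).
      by rewrite ler_pM ?addr_ge0 // ?path ?mulr_ge0 //; lra.
    have epsT : eps * (64%:R * L%:R ^+ 2) <= eps * T%:R by rewrite ler_wpM2l.
    have epsLL : 0 <= eps * L%:R ^+ 2 by rewrite mulr_ge0 ?sqr_ge0.
    rewrite /c in le1 *; lra.
  have sqrt2 : Num.sqrt (2%:R * T%:R) <= 2%:R * r.
    rewrite -(ler_pXn2r (n := 2)) ?nnegrE ?mulr_ge0 ?sqrtr_ge0 //.
    by rewrite exprMn rr sqr_sqrtr ?mulr_ge0 //; have := ler0n R T; lra.
  have := ler_wpM2l eps0 sqrt2; rewrite -exprVn invrK => eps_sqrt2.
  by apply/andP; split; rewrite /c in total_lo total_hi; lra.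
- move=> eps A reg guar t g g1 small.
  have small2 : 16%:R * (\sum_(1 <= i < t.+1) g i) ^+ 2 <= t%:R.
    rewrite -(real_normK (num_real _)) -[leRHS]sqr_sqrtr //.
    set a := `|_| in small *; set r := Num.sqrt _ in small *.
    have a0 : 0 <= a by exact: normr_ge0.
    have r0 : 0 <= r by exact: sqrtr_ge0.
    have : (4%:R * a) ^+ 2 <= r ^+ 2 by rewrite lerXn2r ?nnegrE ?mulr_ge0 //; lra.
    lra.
  (* A norm bounded by [4 * eps] forces [0 <= eps], whence
     [4 * eps <= 32 * eps = 2 * eps / C ^ 2]. *)
  have := output_bound reg guar g1 small2; have := normr_ge0 (output A g t.+1).
  rewrite -exprVn invrK; lra.
Qed.
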